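(* For every integer $k\ge 1$ there exists a $3$-connected nonplanar bipartite cubic graph $G$ with $4k+2$ vertices and $K'(G,3)=2^k$.
   Context: A proper $3$-edge coloring assigns colors from $\{1,2,3\}$ to edges so that adjacent edges receive different colors. For colors $a\neq b$, an edge-Kempe chain is a connected component of the subgraph of edges colored $a$ or $b$; an edge-Kempe switch interchanges $a$ and $b$ on one chain. $K'(G,3)$ is the number of equivalence classes of proper $3$-edge colorings of $G$ under the equivalence relation generated by edge-Kempe switches. *)

(* Defs.v *)
From mathcomp Require Import all_boot.
From mathcomp Require Import perm.
Set Implicit Arguments. Unset Strict Implicit. Unset Printing Implicit Defensive.

Section Graphs.
Variable T : finType.
Implicit Type e : rel T.

Definition simple_graph e := symmetric e /\ irreflexive e.

Definition cubic e := forall v : T, #|[set u | e v u]| = 3.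

Definition bipartite e :=
  exists part : T -> bool, forall u v, e u v -> part u != part v.

Definition del_rel e (S : {set T}) : rel T :=
  [rel x y | [&& e x y, x \notin S & y \notin S]].

Definition k_connected (k : nat) e :=
  k < #|T| /\
  forall S : {set T}, #|S| < k ->
    forall u v, u \notin S -> v \notin S -> connect (del_rel e S) u v.

Definition dart e := {p : T * T | e p.1 p.2}.

Definition edge_set e : {set {set T}} :=
  [set [set p.1; p.2] | p in [pred p : T * T | e p.1 p.2]].

Definition rotation_system e (rho : {perm dart e}) :=
  (forall d : dart e, (val (rho d)).1 = (val d).1) /\
  (forall d d' : dart e, (val d).1 = (val d').1 -> fconnect rho d d').

Definition face_step e (rho : {perm dart e}) : rel (dart e) :=
  fun d d' => [exists d0 : dart e,
                 (val d0 == ((val d).2, (val d).1)) && (rho d0 == d')].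

Definition nfaces e (rho : {perm dart e}) : nat :=
  #|[set [set d' | connect (face_step rho) d d'] | d : dart e]|.

(* A connected graph is planar iff it admits a rotation system of
   Euler genus 0, i.e. V - E + F = 2 (Heffter-Edmonds-Ringel).
   Intended for connected graphs (all graphs it is applied to below are). *)
Definition planar e :=
  exists rho : {perm dart e},
    rotation_system rho /\ #|T| + nfaces rho = #|edge_set e| + 2.

Definition edge e := {A : {set T} | A \in edge_set e}.

Definition coloring e := {ffun edge e -> 'I_3}.

Definition incident e (f g : edge e) := (val f :&: val g) != set0.

Definition proper_coloring e (c : coloring e) :=
  [forall f : edge e, forall g : edge e,
     (f != g) && incident f g ==> (c f != c g)].

Definition ab_rel e (c : coloring e) (a b : 'I_3) : rel (edge e) :=
  fun f g => [&& c f \in [:: a; b], c g \in [:: a; b] & incident f g].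

Definition kempe_chain e (c : coloring e) a b (f0 : edge e) : {set edge e} :=
  [set f | connect (ab_rel c a b) f0 f].

Definition swap3 (a b x : 'I_3) : 'I_3 :=
  if x == a then b else if x == b then a else x.

Definition kempe_switch e (c : coloring e) a b (f0 : edge e) : coloring e :=
  [ffun f => if f \in kempe_chain c a b f0 then swap3 a b (c f) else c f].

Definition kempe_step e (c c' : coloring e) : bool :=
  [exists a : 'I_3, exists b : 'I_3, exists f0 : edge e,
     [&& a != b, c f0 \in [:: a; b] & c' == kempe_switch c a b f0]].

(* symmetric one-step relation on proper colourings; its reflexive
   transitive closure is the equivalence generated by edge-Kempe switches *)
Definition kempe_rel e : rel (coloring e) :=
  fun c c' => [&& proper_coloring c, proper_coloring c' &
                  kempe_step c c' || kempe_step c' c].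

Definition Kprime3 e : nat :=
  #|[set [set c' | connect (@kempe_rel e) c c'] | c in [pred c | proper_coloring c]]|.

End Graphs.

(* Main.v *)
Require Import Defs.
From mathcomp Require Import all_boot.
From mathcomp Require Import perm fingroup.
From mathcomp Require Import zify.
Set Implicit Arguments. Unset Strict Implicit. Unset Printing Implicit Defensive.

(* Gluing k copies of K_{3,3} along 3-edge cuts in a chain gives a ladder: three
   parallel rails of k vertices between two end vertices, with a hub joined to
   the three rail vertices of each level (k = 1 is K_{3,3} itself).

   Nonplanarity: in a plane cubic bipartite graph Euler's formula forces at least
   six quadrilateral faces.  Every 4-cycle of the ladder meets an end vertex, so
   there are at most six such faces, one for each dart leaving an end vertex; but
   for k > 1 the three darts leaving the start vertex cannot all lie on
   quadrilateral faces, as the rotation at some neighbour would then swap two of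
   its three darts.

   Colourings: the colours of the three rail edges at each level are distinct,
   and the hub edges of the next level carry one of the two cyclic shifts of them.
   A proper colouring is thus a permutation of the colours together with k free
   bits.  Every two-coloured subgraph is connected, so a Kempe switch is a global
   transposition of colours: it preserves the bits, and such switches realise all
   permutations of the colours.  Hence there are 2^k classes. *)

(** * Darts, counted by tails and by edges *)

Section Darts.
Variables (T : finType) (e : rel T).
Implicit Types d : dart e.

Definition tail d := (val d).1.
Definition head d := (val d).2.

Lemma dart_adj d : e (tail d) (head d).
Proof. exact: (valP d). Qed.

Lemma dart_inj d1 d2 : tail d1 = tail d2 -> head d1 = head d2 -> d1 = d2.
Proof.
rewrite /tail /head => t12 h12; apply: val_inj.
by case: (val d1) (val d2) t12 h12 => [? ?] [? ?] /= -> ->.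
Qed.

Lemma card_darts_from v : #|[set d | tail d == v]| = #|[set u | e v u]|.
Proof.
rewrite -(@card_in_imset _ _ head) => [|d1 d2]; last first.
  by rewrite !inE => /eqP t1 /eqP t2; apply: dart_inj; rewrite t1 t2.
apply: eq_card => u; rewrite inE; apply/imsetP/idP => [[d]|evu].
  by rewrite inE => /eqP <- ->; exact: dart_adj.
by exists (exist _ (v, u) evu); rewrite // inE.
Qed.

Lemma card_darts : #|{: dart e}| = \sum_v #|[set u | e v u]|.
Proof.
rewrite -sum1_card (partition_big tail predT) //=.
apply: eq_bigr => v _; rewrite -card_darts_from -sum1_card.
by apply: eq_bigl => d; rewrite inE.
Qed.

(** The two ends of an edge lie on different sides, so a dart is recovered from its underlying edge
    and the side of its tail. *)
Lemma card_darts_bipartite : bipartite e -> #|{: dart e}| <= 2 * #|edge_set e|.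
Proof.
case=> part part_e.
pose f d := ([set tail d; head d], part (tail d)).
have f_inj : injective f.
  move=> d1 d2 [E p12]; move: (part_e _ _ (dart_adj d1)) => p1.
  move: (part_e _ _ (dart_adj d2)) => p2.
  have : tail d1 \in [set tail d2; head d2] by rewrite -E set21.
  rewrite !inE; case/orP => /eqP t1; last by rewrite -p12 t1 eqxx in p2.
  have : head d1 \in [set tail d2; head d2] by rewrite -E set22.
  rewrite !inE; case/orP => /eqP h1; last exact: dart_inj.
  by rewrite p12 h1 eqxx in p1.
rewrite -cardsT -(card_imset _ f_inj) mulnC -card_bool -cardsT -cardsX.
apply: subset_leq_card; apply/subsetP => _ /imsetP[d _ ->].
rewrite !inE andbT; apply/imsetP; exists (tail d, head d) => //.
exact: dart_adj.
Qed.

End Darts.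

(** * Faces of a rotation system as permutation orbits *)

Lemma porbits_partition (S : finType) (s : {perm S}) :
  partition (porbits s) setT.
Proof.
apply/and3P; split.
- apply/eqP/setP => x; rewrite inE; apply/bigcupP.
  by exists (porbit s x); [apply: imset_f | apply: porbit_id].
- apply/trivIsetP => _ _ /imsetP[x _ ->] /imsetP[y _ ->] nxy.
  rewrite -setI_eq0; apply/set0Pn => -[z]; rewrite inE => /andP[zx zy].
  move: nxy; rewrite -!eq_porbit_mem in zx zy.
  by rewrite -(eqP zx) -(eqP zy) eqxx.
- by apply/imsetP => -[x _ E]; have := porbit_id s x; rewrite -E inE.
Qed.

Section Faces.
Variables (T : finType) (e : rel T) (rho : {perm dart e}).
Hypotheses (e_sym : symmetric e) (rho_rot : rotation_system rho).
Implicit Types d : dart e.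

Lemma flip_subproof d : e (head d) (tail d).
Proof. by rewrite e_sym dart_adj. Qed.

Definition flip d : dart e := exist _ (head d, tail d) (flip_subproof d).

Lemma flipK : involutive flip.
Proof. by move=> d; apply: dart_inj. Qed.

Lemma face_next_inj : injective (rho \o flip).
Proof. exact: inj_comp perm_inj (inv_inj flipK). Qed.

(** The face-tracing permutation: cross the edge, then rotate at its far end. *)
Definition face_perm : {perm dart e} := perm face_next_inj.

Lemma face_permE d : face_perm d = rho (flip d).
Proof. by rewrite permE. Qed.

Lemma nfacesE : nfaces rho = #|porbits face_perm|.
Proof.
rewrite /nfaces /porbits; congr #|pred_of_set _|; apply: eq_imset => d.
apply/setP => d'; rewrite inE.
have -> : connect (face_step rho) d d' = fconnect face_perm d d'.
  apply: eq_connect => x y; rewrite /face_step /= face_permE.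
  apply/existsP/eqP => [[z /andP[/eqP zE /eqP <-]]|<-].
    by congr (rho _); apply: val_inj.
  by exists (flip x); rewrite !eqxx.
apply/idP/porbitP => [/iter_findex <-|[i ->]].
  by exists (findex face_perm d d'); rewrite permX.
by rewrite permX fconnect_iter.
Qed.

Lemma tail_rho d : tail (rho d) = tail d.
Proof. exact: rho_rot.1. Qed.

Lemma tail_face d : tail (face_perm d) = head d.
Proof. by rewrite face_permE tail_rho. Qed.

Hypothesis e_cubic : cubic e.

(** By [rotation_system] all darts leaving a vertex form one [rho]-cycle; there are three of them,
    too many for a cycle of length at most 2. *)
Lemma rot_no_2cycle d : rho (rho d) <> d.
Proof.
move=> rho2.
have orb d' : tail d = tail d' -> d' \in [set d; rho d].
  move=> tE; have /iter_findex <- := rho_rot.2 d d' tE.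
  elim: (findex _ _ _) => [|n] /=; first by rewrite set21.
  by rewrite !inE => /orP[] /eqP ->; rewrite ?rho2 eqxx ?orbT.
have := e_cubic (tail d); rewrite -card_darts_from => c3.
suff: 3 <= #|[set d; rho d]| by rewrite cards2; case: (_ != _).
rewrite -c3; apply: subset_leq_card; apply/subsetP => d'.
by rewrite inE => /eqP /esym /orb.
Qed.

Lemma rot_no_fixpoint d : rho d <> d.
Proof. by move=> rhod; apply: (@rot_no_2cycle d); rewrite !rhod. Qed.

(** Going straight back along the edge would make [flip d] a fixed point of [rho]. *)
Lemma face_no_backtrack d : head (face_perm d) != tail d.
Proof.
apply/eqP => hE; apply: (@rot_no_fixpoint (flip d)).
by apply: dart_inj; rewrite ?tail_rho // -face_permE hE.
Qed.

Hypothesis e_bip : bipartite e.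

Lemma face_even d : ~~ odd #|porbit face_perm d|.
Proof.
have [part part_e] := e_bip.
have alt n : part (tail (iter n face_perm d)) = odd n (+) part (tail d).
  elim: n => //= n IHn; rewrite tail_face.
  have := part_e _ _ (dart_adj (iter n face_perm d)).
  by rewrite IHn; case: (part (head _)) (odd n) (part _) => [] [] [].
have := alt #|porbit face_perm d|; rewrite iter_porbit.
by case: odd => //; case: (part _).
Qed.

(** Faces are even because tails alternate between the two sides, and length 2 would be a
    backtrack. *)
Lemma face_long d : #|porbit face_perm d| = 4 \/ 6 <= #|porbit face_perm d|.
Proof.
have := face_even d; have := card_porbit_neq0 face_perm d.
have := iter_porbit face_perm d.
case: #|_| => [|[|[|[|[|[|n]]]]]] //= Ed _ _; [|by left|by right].
by have := face_no_backtrack d; rewrite -tail_face Ed eqxx.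
Qed.

Definition quad_faces := [set F in porbits face_perm | #|F| == 4].

Lemma sum_face_sizes : \sum_(F in porbits face_perm) #|F| = 3 * #|T|.
Proof.
rewrite -(@card_partition _ _ setT); last exact: porbits_partition.
rewrite cardsT card_darts (eq_bigr (fun=> 3)) => [|v _]; last exact: e_cubic.
by rewrite sum_nat_const mulnC.
Qed.

(** The faces partition the [3 * #|T|] darts, and each quadrilateral uses four. With six
    quadrilaterals this rules out the 6 vertices of the case k = 1. *)
Lemma card_quad_faces : 4 * #|quad_faces| <= 3 * #|T|.
Proof.
rewrite -sum_face_sizes mulnC -sum_nat_const.
rewrite [X in _ <= X](big_setID quad_faces) /=.
rewrite (setIidPr _); last by apply/subsetP => F; rewrite inE => /andP[].
rewrite (eq_bigr (fun F : {set dart e} => #|F|)) ?leq_addr // => F.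
by rewrite inE => /andP[_ /eqP].
Qed.

(* Euler's formula [V - E + F = 2] with [2E = 3V] gives [\sum_F (6 - |F|) = 12],
   and only the faces of length 4 contribute positively to that sum. *)
Lemma many_quad_faces :
  #|T| + nfaces rho = #|edge_set e| + 2 -> 6 <= #|quad_faces|.
Proof.
rewrite nfacesE => euler.
have nE : 3 * #|T| <= 2 * #|edge_set e|.
  apply: leq_trans (card_darts_bipartite e_bip).
  rewrite card_darts (eq_bigr (fun=> 3)) => [|v _]; last exact: e_cubic.
  by rewrite sum_nat_const mulnC.
have : 6 * #|porbits face_perm| <= 3 * #|T| + 2 * #|quad_faces|.
  rewrite -sum_face_sizes mulnC -sum_nat_const.
  have -> : 2 * #|quad_faces| =
    \sum_(F in porbits face_perm) (if #|F| == 4 then 2 else 0).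
    rewrite -big_mkcondr mulnC -sum_nat_const.
    by apply: eq_bigl => F; rewrite inE.
  rewrite -big_split; apply: leq_sum => _ /imsetP[d _ ->].
  by have [->|] := face_long d => //; case: (_ == 4) => /=; lia.
lia.
Qed.

End Faces.

(* Three rails [rail 1 i, ..., rail k i] join a common start vertex 0 to a common
   end vertex 4k+1, and [hub j] is adjacent to the three vertices at level j.
   Level j >= 1 occupies the numbers 4j-3, ..., 4j, the last one being the hub;
   truncated subtraction collapses level 0 to the start vertex, and [minn]
   collapses level k+1 to the end vertex. *)
Definition rail k j (i : 'I_3) : 'I_(4 * k).+2 :=
  inord (minn (4 * j + i - 3) (4 * k + 1)).

Definition hub k j : 'I_(4 * k).+2 := inord (4 * j).

(** Every edge gets one direction: away from the start on rails, outwards at hubs. The guard [0 < j]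
    avoids a loop, since [hub k 0] is the start vertex itself. *)
Definition ladder_arc k : rel 'I_(4 * k).+2 := fun u v =>
  [exists j : 'I_k.+1, exists i : 'I_3,
    [|| (u == rail k j i) && (v == rail k j.+1 i)
      | [&& 0 < j, u == hub k j & v == rail k j i]]].

Definition ladder k : rel 'I_(4 * k).+2 :=
  fun u v => ladder_arc u v || ladder_arc v u.

(** * Vertices and adjacency of the ladder *)

Section Ladder.
Variable k : nat.
Hypothesis k_gt0 : 0 < k.
Local Notation T := 'I_(4 * k).+2.
Local Notation rail := (rail k).
Local Notation hub := (hub k).
Local Notation ladder := (@ladder k).
Implicit Types (u v x y : T) (i : 'I_3) (j : nat).

Lemma val_rail j i : rail j i = minn (4 * j + i - 3) (4 * k + 1) :> nat.
Proof. by rewrite inordK //; lia. Qed.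

Lemma val_hub j : j <= k -> hub j = 4 * j :> nat.
Proof. by move=> lejk; rewrite inordK //; lia. Qed.

Lemma rail_start i i' : rail 0 i = rail 0 i'.
Proof.
apply: val_inj; rewrite /= !val_rail.
by have := ltn_ord i; have := ltn_ord i'; lia.
Qed.

Lemma rail_end i i' : rail k.+1 i = rail k.+1 i'.
Proof. by apply: val_inj; rewrite /= !val_rail; lia. Qed.

(** Valid at levels 0 and k+1 as well: the collapse there merges rails but never levels. *)
Lemma rail_inj_lev j j' i i' :
  j <= k.+1 -> j' <= k.+1 -> rail j i = rail j' i' -> j = j'.
Proof.
move=> lej lej' /(congr1 val) /=; rewrite !val_rail.
by have := ltn_ord i; have := ltn_ord i'; lia.
Qed.

Lemma rail_inj j : 0 < j <= k -> injective (rail j).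
Proof.
move=> jk i i' /(congr1 val) /=; rewrite !val_rail => E.
by apply: val_inj; have := ltn_ord i; have := ltn_ord i'; rewrite /=; lia.
Qed.

Lemma rail_neq_hub j j' i : 0 < j' <= k -> rail j i <> hub j'.
Proof.
move=> jk /(congr1 val) /=; rewrite val_rail val_hub; last by lia.
by have := ltn_ord i; lia.
Qed.

Lemma hub_inj j j' : j <= k -> j' <= k -> hub j = hub j' -> j = j'.
Proof. by move=> jk jk' /(congr1 val) /=; rewrite !val_hub //; lia. Qed.

Variant vertex_spec : T -> Prop :=
| VertexStart : vertex_spec (rail 0 ord0)
| VertexEnd : vertex_spec (rail k.+1 ord0)
| VertexRail j i of 0 < j <= k : vertex_spec (rail j i)
| VertexHub j of 0 < j <= k : vertex_spec (hub j).

Lemma vertexP u : vertex_spec u.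
Proof.
have := ltn_ord u => ltu.
case: (posnP u) => [u0|u_gt0].
  suff -> : u = rail 0 ord0 by constructor.
  by apply: val_inj; rewrite /= val_rail u0 /=; lia.
case: (ltnP u (4 * k + 1)) => [ltuk|leku]; last first.
  suff -> : u = rail k.+1 ord0 by constructor.
  by apply: val_inj; rewrite /= val_rail /=; lia.
case: (posnP (u %% 4)) => [u4|u4].
  suff -> : u = hub (u %/ 4) by constructor; lia.
  by apply: val_inj; rewrite /= val_hub; lia.
(* The number of [rail j i] is 4(j-1) + (i+1), so quotient and remainder by 4 give j-1 and i+1. *)
have lti : (u %% 4).-1 < 3 by lia.
suff -> : u = rail (u %/ 4).+1 (Ordinal lti) by constructor; lia.
by apply: val_inj; rewrite /= val_rail /=; lia.
Qed.

Lemma ladder_sym : symmetric ladder.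
Proof. by move=> u v; rewrite /ladder orbC. Qed.

Lemma ladder_rail j i : j <= k -> ladder (rail j i) (rail j.+1 i).
Proof.
move=> lejk; apply/orP; left; apply/existsP; exists (inord j).
by apply/existsP; exists i; rewrite inordK // !eqxx.
Qed.

Lemma ladder_hub j i : 0 < j <= k -> ladder (hub j) (rail j i).
Proof.
case/andP=> j_gt0 lejk; apply/orP; left; apply/existsP; exists (inord j).
by apply/existsP; exists i; rewrite inordK // !eqxx j_gt0 orbT.
Qed.

Variant arc_spec : T -> T -> Prop :=
| ArcRail j i of j <= k : arc_spec (rail j i) (rail j.+1 i)
| ArcHub j i of 0 < j <= k : arc_spec (hub j) (rail j i).

Lemma ladderP u v : ladder u v -> arc_spec u v \/ arc_spec v u.
Proof.
case/orP=> /existsP[j /existsP[i /orP[/andP[/eqP-> /eqP->]|]]].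
- by left; constructor; rewrite -ltnS.
- by case/and3P=> j_gt0 /eqP-> /eqP->; left; constructor; rewrite j_gt0 -ltnS /=.
- by right; constructor; rewrite -ltnS.
- by case/and3P=> j_gt0 /eqP-> /eqP->; right; constructor; rewrite j_gt0 -ltnS /=.
Qed.

Lemma ladder_from_rail j i v : 0 < j <= k -> ladder (rail j i) v ->
  [\/ v = rail j.-1 i, v = rail j.+1 i | v = hub j].
Proof.
move=> jk; move Eu: (rail j i) => u /ladderP[] uv; case: uv Eu => j' i' j'k.
- move=> E; have ? : j = j' by apply: rail_inj_lev E; lia.
  by subst j'; rewrite (rail_inj _ E) //; constructor 2.
- by move=> E; case: (rail_neq_hub j'k E).
- move=> E; have ? : j = j'.+1 by apply: rail_inj_lev E; lia.
  by subst j; rewrite (rail_inj _ E) //; constructor 1.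
- move=> E; have ? : j = j' by apply: rail_inj_lev E; lia.
  by subst j'; constructor 3.
Qed.

Lemma ladder_from_hub j v : 0 < j <= k -> ladder (hub j) v ->
  exists i, v = rail j i.
Proof.
move=> jk; move Eu: (hub j) => u /ladderP[] uv; case: uv Eu => j' i' j'k.
- by move=> E; case: (rail_neq_hub jk (esym E)).
- by move/hub_inj => <-; [exists i' | lia | lia].
- by move=> E; case: (rail_neq_hub jk (esym E)).
- by move=> E; case: (rail_neq_hub jk (esym E)).
Qed.

Lemma ladder_from_start i0 v : ladder (rail 0 i0) v -> exists i, v = rail 1 i.
Proof.
move Eu: (rail 0 i0) => u /ladderP[] uv; case: uv Eu => j' i' j'k.
- by move/rail_inj_lev => <-; [exists i' | lia | lia].
- by move=> E; case: (rail_neq_hub j'k E).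
- by move/rail_inj_lev; lia.
- by move/rail_inj_lev; lia.
Qed.

Lemma ladder_from_end i0 v : ladder (rail k.+1 i0) v -> exists i, v = rail k i.
Proof.
move Eu: (rail k.+1 i0) => u /ladderP[] uv; case: uv Eu => j' i' j'k.
- by move/rail_inj_lev; lia.
- by move=> E; case: (rail_neq_hub j'k E).
- move=> E; have -> : k = j' by apply: succn_inj; apply: rail_inj_lev E; lia.
  by exists i'.
- by move/rail_inj_lev; lia.
Qed.

(** * Bipartiteness, degrees and 3-connectivity *)

Lemma ladder_bipartite : bipartite ladder.
Proof.
(* [(u + 3) %/ 4] is the level of [u]; hubs, the positive multiples of 4, take the side opposite to
   the rail vertices of their level. *)
pose side u := odd ((u + 3) %/ 4) (+) ((0 < u) && (4 %| u)).
have side_rail j i : j <= k.+1 -> side (rail j i) = odd j.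
  move=> lej; have lti := ltn_ord i; rewrite /side val_rail.
  case: (posnP j) => [->|j_gt0].
    by have -> : minn (4 * 0 + i - 3) (4 * k + 1) = 0 by lia.
  have -> : 4 %| minn (4 * j + i - 3) (4 * k + 1) = false by lia.
  by rewrite andbF addbF; congr odd; lia.
have side_hub j : 0 < j <= k -> side (hub j) = ~~ odd j.
  move=> jk; rewrite /side val_hub; last by lia.
  have -> : (0 < 4 * j) && (4 %| 4 * j) by lia.
  by rewrite addbT; congr (~~ odd _); lia.
exists side => u v /ladderP[] [] j i jk; rewrite ?side_rail ?side_hub //; try lia.
all: by rewrite /=; case: odd.
Qed.

Lemma ladder_simple : simple_graph ladder.
Proof.
split=> [|u]; first exact: ladder_sym.
have [side side_e] := ladder_bipartite.
by apply: contraTF isT => /side_e; rewrite eqxx.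
Qed.

Lemma ladder_cubic : cubic ladder.
Proof.
(* The neighbourhood of an end vertex or of a hub is a full row of rail vertices. *)
have card_row j (A : {set T}) : 0 < j <= k ->
    (forall v, v \in A <-> exists i, v = rail j i) -> #|A| = 3.
  move=> jk AE; rewrite -[RHS]card_ord -cardsT -(card_imset _ (rail_inj jk)).
  apply: eq_card => v; apply/idP/imsetP => [/AE[i ->]|[i _ ->]]; first by exists i.
  by apply/AE; exists i.
move=> u; case: (vertexP u) => [||j i jk|j jk].
- apply: (card_row 1); [by lia | move=> v; rewrite inE; split].
    exact: ladder_from_start.
  by case=> i ->; rewrite (rail_start _ i) ladder_rail.
- apply: (card_row k); [by lia | move=> v; rewrite inE; split].
    exact: ladder_from_end.
  by case=> i ->; rewrite (rail_end _ i) ladder_sym ladder_rail.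
- have -> : [set v | ladder (rail j i) v] = [set rail j.-1 i; rail j.+1 i; hub j].
    apply/setP => v; rewrite !inE; apply/idP/idP.
      by move/(ladder_from_rail jk) => [] ->; rewrite eqxx ?orbT.
    case/orP=> [/orP[]|] /eqP->.
    - have {1}-> : j = j.-1.+1 by lia.
      by rewrite ladder_sym ladder_rail; lia.
    - by rewrite ladder_rail; lia.
    - by rewrite ladder_sym ladder_hub.
  rewrite -setUA !cardsU1 cards1 !inE.
  have /eqP/negPf-> := @rail_neq_hub j.-1 j i jk.
  have /eqP/negPf-> := @rail_neq_hub j.+1 j i jk.
  have /eqP/negPf-> // : rail j.-1 i <> rail j.+1 i.
  by move/rail_inj_lev; lia.
- by apply: (card_row j _ jk) => v; rewrite inE; split=> [/(ladder_from_hub jk)|[i ->]] //; rewrite ladder_hub.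
Qed.

(* At most two deleted vertices miss one of the three rails.  Every other
   surviving vertex reaches that rail through its hub, or along its own rail to
   the left, or to the right, and these three routes are disjoint. *)
Lemma ladder_3connected : k_connected 3 ladder.
Proof.
split=> [|S S3]; first by rewrite card_ord; lia.
pose R := connect (del_rel ladder S).
have R_sym x y : R x y = R y x.
  apply: (sym_connect_sym _ x y) => a b.
  by rewrite /del_rel /= ladder_sym [X in _ && X]andbC.
have step x y : ladder x y -> x \notin S -> y \notin S -> R x y.
  by move=> xy xS yS; apply: connect1; apply/and3P.
have [i freei] : exists i, forall j, 0 < j <= k -> rail j i \notin S.
  pose hit i := [exists j : 'I_k.+1, (0 < j) && (rail j i \in S)].
  case: (boolP [forall i, hit i]) => [/forallP hitP|]; last first.
    rewrite negb_forall => /existsP[i /existsPn nhit]; exists i => j /andP[j_gt0 lejk].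
    by have := nhit (inord j); rewrite inordK // j_gt0.
  (* If [S] met every rail, a deleted vertex chosen on each would give three distinct elements of
     [S], as rails are disjoint at inner levels. *)
  pose f i := rail (xchoose (existsP (hitP i))) i.
  have f_inj : injective f.
    move=> i i' ff; have E := ff; have := ltn_ord (xchoose (existsP (hitP i))).
    have /andP[j_gt0 _] := xchooseP (existsP (hitP i)).
    have := ltn_ord (xchoose (existsP (hitP i'))).
    move: E; rewrite /f => /rail_inj_lev E ltj' ltj.
    rewrite /f -E in ff; [|lia|lia].
    by apply: rail_inj ff; rewrite j_gt0.
  have fS : f @: setT \subset S.
    apply/subsetP => _ /imsetP[i _ ->].
    by have /andP[] := xchooseP (existsP (hitP i)).
  by have := subset_leq_card fS; rewrite card_imset // cardsT card_ord leqNgt S3.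
have R_rail j : 0 < j <= k -> R (rail 1 i) (rail j i).
  elim: j => // -[|j] IHj jk; first exact: connect0.
  apply: connect_trans (IHj _) (step _ _ _ _ _); [lia| apply: ladder_rail; lia |apply: freei; lia |exact: freei].
have R_hub j : 0 < j <= k -> hub j \notin S -> R (rail 1 i) (hub j).
  move=> jk jS; apply: connect_trans (R_rail j jk) _.
  by rewrite -/(R _ _) R_sym; apply: step => //; [exact: ladder_hub | exact: freei].
have R_start i' : rail 0 i' \notin S -> R (rail 1 i) (rail 0 i').
  rewrite (rail_start _ i) => jS; rewrite R_sym.
  by apply: step => //; [exact: ladder_rail | apply: freei; lia].
have R_end i' : rail k.+1 i' \notin S -> R (rail 1 i) (rail k.+1 i').
  rewrite (rail_end _ i) => jS; apply: connect_trans (R_rail k _) _; first by lia.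
  by apply: step => //; [exact: ladder_rail | apply: freei; lia].
suff hubR u : u \notin S -> R (rail 1 i) u.
  by move=> u v uS vS; apply: connect_trans (hubR v vS); rewrite -/(R _ _) R_sym; exact: hubR.
move=> uS; case: (vertexP u) uS => [||j i' jk|j jk] uS.
- exact: R_start.
- exact: R_end.
- case: (boolP (hub j \in S)) => [hS|]; last first.
    move=> hS; apply: connect_trans (R_hub j jk hS) _.
    by apply: step => //; exact: ladder_hub.
  have Rback j' : ladder (rail j i') (rail j' i') -> rail j' i' \notin S ->
      R (rail 1 i) (rail j' i') -> R (rail 1 i) (rail j i').
    move=> jj' j'S /connect_trans; apply; apply: step => //.
    by rewrite ladder_sym.
  (* A blocked route through the adjacent level j' leaves a witness in [S] at that level: the rail
     vertex or its hub. With [hub j], the two witnesses occupy three different levels. *)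
  have side (j' : nat) : (j' = j.-1 \/ j' = j.+1) ->
      R (rail 1 i) (rail j i') \/
      exists2 x, x \in S & x = rail j' i' \/ 0 < j' <= k /\ x = hub j'.
    move=> jj'; have jj'_adj : ladder (rail j i') (rail j' i').
      case: jj' => ->; last by apply: ladder_rail; lia.
      have {1}-> : j = j.-1.+1 by lia.
      by rewrite ladder_sym; apply: ladder_rail; lia.
    case: (boolP (rail j' i' \in S)) => [|rS].
      by right; exists (rail j' i'); [|left].
    case: (posnP j') => [j'0|j'_gt0].
      by left; apply: (Rback j' jj'_adj rS); move: rS; rewrite j'0; exact: R_start.
    case: (ltnP k j') => [ltkj'|lej'k].
      have j'E : j' = k.+1 by lia.
      by left; apply: (Rback j' jj'_adj rS); move: rS; rewrite j'E; exact: R_end.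
    have j'k : 0 < j' <= k by rewrite j'_gt0.
    case: (boolP (hub j' \in S)) => [|hS'].
      by right; exists (hub j'); [|right].
    left; apply: (Rback j' jj'_adj rS); apply: connect_trans (R_hub j' j'k hS') _.
    by apply: step => //; exact: ladder_hub.
  have [//|[x xS xE]] := side j.-1 (or_introl erefl).
  have [//|[y yS yE]] := side j.+1 (or_intror erefl).
  suff : 3 <= #|S| by rewrite leqNgt S3.
  have lti' := ltn_ord i'.
  have [hx hy xy] : [/\ hub j != x, hub j != y & x != y].
    by split; apply/eqP => /(congr1 val) /=; case: xE => [xE|[jx xE]];
      case: yE => [yE|[jy yE]]; rewrite ?xE ?yE ?val_rail ?val_hub; lia.
  have sS : [set hub j; x; y] \subset S.
    by apply/subsetP => z; rewrite !inE => /orP[/orP[]|] /eqP->.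
  apply: leq_trans (subset_leq_card sS).
  by rewrite -setUA !cardsU1 cards1 !inE negb_or hx hy xy.
- exact: R_hub.
Qed.

(** * Nonplanarity: short cycles and quadrilateral faces *)

Definition ladder_ends : {set T} := [set rail 0 ord0; rail k.+1 ord0].

Lemma rail_inner j i :
  j <= k.+1 -> rail j i \notin ladder_ends -> 0 < j <= k.
Proof.
move=> lej; rewrite !inE negb_or => /andP[/eqP n0 /eqP nk].
case: (posnP j) => [j0|j_gt0]; first by case: n0; rewrite j0; apply: rail_start.
rewrite leqNgt; apply/negP => ltkj; case: nk.
by have -> : j = k.+1 by [lia]; apply: rail_end.
Qed.

(** [hub j] sees only level j, where an inner [rail j.-1 i] or [rail j.+1 i] sees only [rail j i];
    those two rail vertices have different hubs. An end vertex would break this, being adjacent to a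
    whole row. *)
Lemma inner_common_neighbour j i v y x :
    0 < j <= k -> v \notin ladder_ends -> y \notin ladder_ends -> v <> y ->
    ladder (rail j i) v -> ladder (rail j i) y -> ladder v x -> ladder y x ->
  x = rail j i.
Proof.
move=> jk vN yN vy uv uy.
have hub_rail j' z : j' = j.-1 \/ j' = j.+1 -> rail j' i \notin ladder_ends ->
    ladder (hub j) z -> ladder (rail j' i) z -> z = rail j i.
  move=> jj' /rail_inner j'k /(ladder_from_hub jk)[i' ->].
  have {}j'k : 0 < j' <= k by apply: j'k; lia.
  case/(ladder_from_rail j'k) => E; last by case: (rail_neq_hub j'k E).
    have Ej : j = j'.-1 by apply: rail_inj_lev E; lia.
    by move: E; rewrite -Ej => E; rewrite (rail_inj jk E).
  have Ej : j = j'.+1 by apply: rail_inj_lev E; lia.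
  by move: E; rewrite -Ej => E; rewrite (rail_inj jk E).
have rail_rail z : rail j.-1 i \notin ladder_ends -> rail j.+1 i \notin ladder_ends ->
    ladder (rail j.-1 i) z -> ladder (rail j.+1 i) z -> z = rail j i.
  move=> /rail_inner jp /rail_inner js.
  have {}jp : 0 < j.-1 <= k by apply: jp; lia.
  have {}js : 0 < j.+1 <= k by apply: js; lia.
  move=> pz sz; case: (ladder_from_rail js sz) => // zE; move: pz; rewrite zE;
    case/(ladder_from_rail jp) => E.
  - by have := rail_inj_lev _ _ E; lia.
  - by have := rail_inj_lev _ _ E; lia.
  - by case: (rail_neq_hub jp E).
  - by case: (rail_neq_hub js (esym E)).
  - by case: (rail_neq_hub js (esym E)).
  - by have := hub_inj _ _ E; lia.
move: vN yN vy; case/(ladder_from_rail jk): uv => ->;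
  case/(ladder_from_rail jk): uy => -> vN yN vy vx yx //.
- exact: rail_rail.
- by apply: hub_rail vN yx vx; left.
- exact: rail_rail.
- by apply: hub_rail vN yx vx; right.
- by apply: hub_rail yN vx yx; left.
- by apply: hub_rail yN vx yx; right.
Qed.

(** If the cycle avoided the end vertices, then [u], or [v] when [u] is a hub, would be a rail
    vertex, and [inner_common_neighbour] there would make opposite corners equal. *)
Lemma ladder_4cycle u v x y :
    ladder u v -> ladder v x -> ladder x y -> ladder y u -> x <> u -> y <> v ->
  [|| u \in ladder_ends, v \in ladder_ends, x \in ladder_ends | y \in ladder_ends].
Proof.
move=> uv vx xy yu xu yv; apply/negPn; rewrite !negb_or.
apply/negP => /and4P[uN vN xN yN]; have vu := uv; rewrite ladder_sym in vu.
move: uN uv yu xu vu; case: (vertexP u) => [||j i jk|j jk] uN uv yu xu vu.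
- by rewrite set21 in uN.
- by rewrite set22 in uN.
- case: xu; apply: (@inner_common_neighbour j i v y) => // [/esym //||].
    by rewrite ladder_sym.
  by rewrite ladder_sym.
- have [i vE] := ladder_from_hub jk uv; subst v.
  case: yv; apply: (@inner_common_neighbour j i x (hub j)) => //.
  by rewrite ladder_sym.
Qed.

Lemma ladder_nonplanar : ~ planar ladder.
Proof.
case=> rho [rot euler]; pose phi := face_perm rho ladder_sym.
have q6 : 6 <= #|quad_faces rho ladder_sym|.
  exact: many_quad_faces rot ladder_cubic ladder_bipartite euler.
have q4 := @card_quad_faces _ _ rho ladder_sym ladder_cubic.
rewrite card_ord in q4.
(* Six quadrilaterals need 24 of the 12k + 6 darts. *)
have k_gt1 : 1 < k by lia.
have tail_phi d : tail (phi d) = head d by exact: tail_face.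
have walk d : #|porbit phi d| = 4 ->
  [/\ head (phi (phi (phi d))) = tail d, head (phi d) <> tail d
    & head (phi (phi d)) <> head d].
  move=> d4; have := iter_porbit phi d; rewrite d4 /= => E.
  split; first by rewrite -tail_phi E.
    by apply/eqP; exact: (face_no_backtrack ladder_sym rot ladder_cubic).
  rewrite -[head d]tail_phi.
  by apply/eqP; exact: (face_no_backtrack ladder_sym rot ladder_cubic).
pose spoke i : dart ladder := exist _ (rail 0 i, rail 1 i) (ladder_rail i (leq0n k)).
have [i0 n4] : exists i, #|porbit phi (spoke i)| != 4.
  apply/existsP; rewrite -negb_forall; apply/negP => /forallP all4.
  (* The corner opposite the start vertex is [hub 1]: the alternative [rail 2 i] is, for k > 1,
     adjacent to no other [rail 1 i']. *)
  have fourth i : exists2 i', i' <> i &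
      tail (phi (phi (spoke i))) = hub 1 /\ tail (phi (phi (phi (spoke i)))) = rail 1 i'.
    have [w1 w2 w3] := walk _ (eqP (all4 i)).
    set d1 := phi (spoke i) in w1 w2 w3 *; set d2 := phi d1 in w1 w3 *.
    set d3 := phi d2 in w1 *.
    have [i' yE] : exists i', tail d3 = rail 1 i'.
      apply: (@ladder_from_start i); rewrite ladder_sym -[rail 0 i]w1.
      exact: dart_adj.
    exists i'; first by move=> ii'; case: w3; rewrite -tail_phi -/d3 yE ii'.
    split=> //.
    have : ladder (rail 1 i) (tail d2).
      by have := dart_adj d1; rewrite -[head d1]tail_phi -/d2 [tail d1]tail_phi.
    case/ladder_from_rail => // E; first by case: w2; rewrite -tail_phi -/d2 E.
    have : ladder (rail 1 i') (rail 2 i).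
      by have := dart_adj d2; rewrite -[head d2]tail_phi -/d3 yE E ladder_sym.
    case/ladder_from_rail => // E2.
    - by have := rail_inj_lev _ _ E2; lia.
    - have ii' : i = i' by apply: rail_inj E2; lia.
      by case: w3; rewrite -tail_phi -/d3 yE -ii'.
    - by case: (rail_neq_hub _ E2); lia.
  (* At [rail 1 i'], the face of [spoke ord0] arrives from [hub 1] and leaves to the start vertex,
     while the face of [spoke i'] does the reverse. So [rho] swaps two darts. *)
  have [i' _ [d2E d3E]] := fourth ord0.
  have [_ _ [d2'E _]] := fourth i'.
  have [w1 _ _] := walk _ (eqP (all4 ord0)).
  apply: (@rot_no_2cycle _ _ _ rot ladder_cubic (flip ladder_sym (spoke i'))).
  rewrite -face_permE -/phi.
  have -> : phi (spoke i') = flip ladder_sym (phi (phi (spoke ord0))).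
    apply: dart_inj; last first.
      by rewrite -tail_phi d2'E -d2E.
    by rewrite -[RHS]/(head (phi (phi (spoke ord0)))) -[RHS]tail_phi d3E tail_phi.
  rewrite -face_permE; apply: dart_inj; first by rewrite d3E.
  by rewrite w1; apply: rail_start.
(* Each quadrilateral face is the orbit of one of the six darts leaving an end vertex; without
   [spoke i0] only five remain. *)
pose D := [set d : dart ladder | tail d \in ladder_ends].
have D6 : #|D| <= 6.
  have -> : D = [set d | tail d == rail 0 ord0] :|: [set d | tail d == rail k.+1 ord0].
    by apply/setP => d; rewrite !inE.
  by rewrite (leq_trans (leq_card_setU _ _)) // !card_darts_from !ladder_cubic.
have sD : spoke i0 \in D by rewrite !inE /tail /= (rail_start i0 ord0) eqxx.
have sub : quad_faces rho ladder_sym \subset porbit phi @: (D :\ spoke i0).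
  apply/subsetP => F; rewrite inE => /andP[/imsetP[d _ ->] /eqP d4].
  have hit d' : d' \in porbit phi d -> tail d' \in ladder_ends ->
      porbit phi d \in porbit phi @: (D :\ spoke i0).
    rewrite -eq_porbit_mem => /eqP d'E d'D; apply/imsetP; exists d'; last by [].
    rewrite !inE -in_set2 d'D andbT; apply: contraNneq n4 => <-.
    by rewrite d'E; apply/eqP.
  have [w1 w2 w3] := walk _ d4.
  have mem n : iter n phi d \in porbit phi d by rewrite -permX mem_porbit.
  have a0 := dart_adj d.
  have a1 := dart_adj (phi d); rewrite tail_phi in a1.
  have a2 := dart_adj (phi (phi d)); rewrite tail_phi in a2.
  have a3 := dart_adj (phi (phi (phi d))); rewrite tail_phi w1 in a3.
  case/or4P: (ladder_4cycle a0 a1 a2 a3 w2 w3).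
  - exact: hit _ (mem 0).
  - by rewrite -tail_phi; exact: hit _ (mem 1).
  - by rewrite -tail_phi; exact: hit _ (mem 2).
  - by rewrite -tail_phi; exact: hit _ (mem 3).
have := leq_trans q6 (leq_trans (subset_leq_card sub) (leq_imset_card _ _)).
by move: D6; rewrite (cardsD1 (spoke i0) D) sD /= => D6 q5; have := leq_trans q5 D6.
Qed.

End Ladder.

(** * Derangements of three colours *)

Section ThreeColours.
Implicit Types i x y : 'I_3.

(** The two derangements of three points, indexed by a bit; negating the bit inverts the shift. *)
Definition shift (d : bool) i : 'I_3 := if d then ordS i else ord_pred i.

Lemma shift_cases i x : [\/ x = i, x = shift true i | x = shift false i].
Proof.
case: i x => [[|[|[|i]]] lti] [[|[|[|x]]] ltx] //.
all: by [constructor 1; apply: val_inj | constructor 2; apply: val_inj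
        | constructor 3; apply: val_inj].
Qed.

Lemma shift_neq d i : shift d i <> i.
Proof. by case: d i => [] [[|[|[|i]]] lti] //= /(congr1 val). Qed.

Lemma shiftNK d i : shift (~~ d) (shift d i) = i.
Proof. by case: d i => [] [[|[|[|i]]] lti] //=; apply: val_inj. Qed.

Lemma shift2 d i : shift d (shift d i) = shift (~~ d) i.
Proof. by case: d i => [] [[|[|[|i]]] lti] //=; apply: val_inj. Qed.

Lemma shift_inj d : injective (shift d).
Proof. exact: can_inj (shiftNK d). Qed.

Lemma shift_negb d i : shift d i <> shift (~~ d) i.
Proof. by rewrite -shift2 => /esym /shift_neq. Qed.

Lemma shift_other d i x : x <> i -> x <> shift d i -> x = shift (~~ d) i.
Proof. by case: (shift_cases i x) => ->; case: d. Qed.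

Variables a b c : 'I_3 -> 'I_3.
Hypotheses (a_inj : injective a) (b_inj : injective b).
Hypotheses (ab : forall i, a i <> b i) (ac : forall i, a i <> c i)
  (bc : forall i, b i <> c i).

Lemma inj3_other d i x : x <> a i -> x <> a (shift d i) -> x = a (shift (~~ d) i).
Proof.
have [a' _ aK] := injF_bij a_inj; rewrite -[x]aK => xi xd; congr a.
by apply: shift_other => E; [case: xi | case: xd]; rewrite E.
Qed.

(* [b] is a derangement relative to the bijection [a], hence one of the two
   cyclic shifts of it; [c] is then forced to be the other one. *)
Lemma derangement_shift (d := b ord0 == a (shift true ord0)) i :
  b i = a (shift d i) /\ c i = a (shift (~~ d) i).
Proof.
have bd : b ord0 = a (shift d ord0).
  rewrite /d; case: eqP => // n; apply: (inj3_other (d := true)) n.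
  exact/nesym.
(* At the index [shift (~~ d) i'], [ab] excludes one colour and injectivity of [b] excludes [b i'].
   Two such moves from [ord0] reach every index. *)
have next i' : b i' = a (shift d i') -> b (shift (~~ d) i') = a (shift d (shift (~~ d) i')).
  move=> bi'; rewrite -{2}[d]negbK; apply: inj3_other; first exact/nesym.
  rewrite shift2 negbK -bi' => /b_inj; exact: shift_neq.
have {}bd : forall i, b i = a (shift d i).
  move=> i'; have b1 := next _ bd; have := next _ b1; rewrite shift2 negbK => b2.
  by case: (shift_cases ord0 i') => ->; case: (d) b1 b2 bd.
split=> //; apply: inj3_other; first exact/nesym.
by rewrite -bd; apply/nesym.
Qed.

Lemma shift_from0 d : (shift d ord0 == shift true ord0) = d.
Proof. by case: d; rewrite -val_eqE. Qed.

End ThreeColours.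

(** Turns membership in a two-coloured subgraph into avoidance of a single colour. *)
Lemma third_colour (a b : 'I_3) :
  a != b -> exists m, forall x, (x \in [:: a; b]) = (x != m).
Proof.
move=> /eqP ab; have [d bE] : exists d, b = shift d a.
  by case: (shift_cases a b) => [E|->|->]; [case: ab | exists true | exists false].
exists (shift (~~ d) a) => x; rewrite bE !inE; apply/idP/negP => [/orP[] /eqP-> /eqP|/negP/eqP n].
- exact/nesym/shift_neq.
- exact: shift_negb.
apply/orP; case: (x =P a) => [->|xa]; [by left | right; apply/eqP].
by rewrite (shift_other xa n) negbK.
Qed.

(** * Global recolourings and Kempe switches *)

Section Recolouring.
Variables (T : finType) (e : rel T).
Implicit Type c : coloring e.

Definition recolour (s : {perm 'I_3}) c : coloring e := [ffun f => s (c f)].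

Lemma recolour_proper s c : proper_coloring c -> proper_coloring (recolour s c).
Proof.
move=> /forallP c_proper; apply/forallP => f; apply/forallP => g.
have /forallP/(_ g) := c_proper f; rewrite !ffunE => /implyP cfg.
by apply/implyP => /cfg; apply: contraNneq => /perm_inj ->.
Qed.

Lemma proper_coloringP c :
  reflect (forall f g, f != g -> incident f g -> c f <> c g) (proper_coloring c).
Proof.
apply: (iffP forallP) => c_proper f => [g fg ifg|].
  by have /forallP/(_ g) := c_proper f; rewrite fg ifg => /eqP.
by apply/forallP => g; apply/implyP => /andP[fg ifg]; apply/eqP; apply: c_proper.
Qed.

Lemma edgeP (f : edge e) : exists u v, e u v /\ val f = [set u; v].
Proof. by have /imsetP[[u v] uv ->] := valP f; exists u, v. Qed.

Lemma incidentP (f g : edge e) :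
  reflect (exists2 u, u \in val f & u \in val g) (incident f g).
Proof.
apply: (iffP (set0Pn _)) => -[u]; first by rewrite inE => /andP[]; exists u.
by move=> uf ug; exists u; rewrite inE uf.
Qed.

Lemma ab_rel_sym c a b : symmetric (ab_rel c a b).
Proof.
move=> f g; rewrite /ab_rel andbCA; congr [&& _, _ & _].
by rewrite /incident setIC.
Qed.

Definition kempe_connected c := forall a b f g, a != b ->
  c f \in [:: a; b] -> c g \in [:: a; b] -> connect (ab_rel c a b) f g.

(** The chain of [f] is then the whole set of edges coloured [a] or [b], and [tperm a b] fixes the
    remaining colour. *)
Lemma kempe_switch_recolour c a b f : kempe_connected c -> a != b ->
  c f \in [:: a; b] -> kempe_switch c a b f = recolour (tperm a b) c.
Proof.
move=> c_conn ab cf; apply/ffunP => g; rewrite !ffunE inE.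
have -> : swap3 a b (c g) = tperm a b (c g) by rewrite permE.
case: (boolP (c g \in [:: a; b])) => cg; first by rewrite c_conn.
by move: cg; rewrite !inE negb_or => /andP[/eqP ga /eqP gb]; rewrite tpermD ?if_same //; apply/eqP/nesym.
Qed.

End Recolouring.

(** * Edges of the ladder and their local colour constraints *)

Section LadderColourings.
Variable k : nat.
Hypothesis k_gt0 : 0 < k.
Local Notation T := 'I_(4 * k).+2.
Local Notation rail := (rail k).
Local Notation hub := (hub k).
Local Notation ladder := (@ladder k).
Local Notation edge := (edge ladder).
Local Notation coloring := (coloring ladder).
Implicit Types (i : 'I_3) (j : nat) (f g : edge) (c : coloring).

Lemma mem_edge_set (u v : T) : ladder u v -> [set u; v] \in edge_set ladder.
Proof. by move=> uv; apply/imsetP; exists (u, v). Qed.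

(** Default value making [rail_edge] and [hub_edge] total in the level; it is not reached for j <=
    k, respectively 0 < j <= k. *)
Definition edge0 : edge :=
  exist (fun A => A \in edge_set ladder) _ (mem_edge_set (ladder_rail ord0 (leq0n k))).

Definition rail_edge j i : edge := insubd edge0 [set rail j i; rail j.+1 i].

Definition hub_edge j i : edge := insubd edge0 [set hub j; rail j i].

Lemma val_rail_edge j i : j <= k -> val (rail_edge j i) = [set rail j i; rail j.+1 i].
Proof. by move=> jk; rewrite insubdK //; apply: mem_edge_set; apply: ladder_rail. Qed.

Lemma val_hub_edge j i : 0 < j <= k -> val (hub_edge j i) = [set hub j; rail j i].
Proof. by move=> jk; rewrite insubdK //; apply: mem_edge_set; apply: ladder_hub. Qed.

Variant edge_spec : edge -> Prop :=
| RailEdge j i of j <= k : edge_spec (rail_edge j i)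
| HubEdge j i of j < k : edge_spec (hub_edge j.+1 i).

Lemma ladder_edgeP f : edge_spec f.
Proof.
have arc_edge u v : val f = [set u; v] -> arc_spec u v -> edge_spec f.
  move=> fE uv; case: uv fE => j i jk fE.
    have -> : f = rail_edge j i by apply: val_inj; rewrite val_rail_edge.
    exact: RailEdge.
  have -> : f = hub_edge j i by apply: val_inj; rewrite val_hub_edge.
  by case: j jk {fE} => // j jk; exact: HubEdge.
have [u [v [uv fE]]] := edgeP f.
by case: (ladderP uv); apply: arc_edge; rewrite // setUC.
Qed.

Lemma rail_edge_inj j j' i i' : j <= k -> j' <= k ->
  rail_edge j i = rail_edge j' i' -> j = j' /\ i = i'.
Proof.
move=> jk j'k /(congr1 val); rewrite !val_rail_edge // => E.
have jj' : j = j'.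
  have : rail j i \in [set rail j' i'; rail j'.+1 i'] by rewrite -E set21.
  have : rail j' i' \in [set rail j i; rail j.+1 i] by rewrite E set21.
  rewrite !inE => /orP[]/eqP/rail_inj_lev E1 /orP[]/eqP/rail_inj_lev E2; lia.
(* At level 0 the near ends coincide, so the rail is read off the far ends; at other levels the near
   ends tell the rails apart. *)
split=> //; subst j'; case: (posnP j) => [j0|j_gt0].
  subst j; have : rail 1 i \in [set rail 0 i'; rail 1 i'] by rewrite -E set22.
  rewrite !inE => /orP[]/eqP; first by move/rail_inj_lev; lia.
  by apply: rail_inj.
have : rail j i \in [set rail j i'; rail j.+1 i'] by rewrite -E set21.
rewrite !inE => /orP[]/eqP; last by move/rail_inj_lev; lia.
by apply: rail_inj; rewrite // j_gt0.
Qed.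

Lemma hub_edge_inj j j' i i' : j < k -> j' < k ->
  hub_edge j.+1 i = hub_edge j'.+1 i' -> j = j' /\ i = i'.
Proof.
move=> jk j'k /(congr1 val); rewrite !val_hub_edge // => E.
have : hub j.+1 \in [set hub j'.+1; rail j'.+1 i'] by rewrite -E set21.
rewrite !inE => /orP[]/eqP; last by move/esym/rail_neq_hub; case.
move/hub_inj => jj'; have {}jj' : j = j' by apply: succn_inj; apply: jj'.
subst j'; split=> //.
have : rail j.+1 i \in [set hub j.+1; rail j.+1 i'] by rewrite -E set22.
rewrite !inE => /orP[]/eqP; first by move/rail_neq_hub; case.
by apply: rail_inj.
Qed.

Lemma rail_edge_neq_hub j j' i i' : j <= k -> j' < k ->
  rail_edge j i <> hub_edge j'.+1 i'.
Proof.
move=> jk j'k /(congr1 val); rewrite val_rail_edge // val_hub_edge // => E.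
have : hub j'.+1 \in [set rail j i; rail j.+1 i] by rewrite E set21.
by rewrite !inE => /orP[]/eqP/esym/rail_neq_hub; case.
Qed.

Lemma incident_rail_edges j i : j < k ->
  incident (rail_edge j i) (rail_edge j.+1 i).
Proof.
move=> jk; apply/incidentP; exists (rail j.+1 i); rewrite val_rail_edge //.
- by rewrite set22.
- exact: ltnW.
by rewrite set21.
Qed.

Lemma incident_hub_edges j i i' : j < k ->
  incident (hub_edge j.+1 i) (hub_edge j.+1 i').
Proof.
by move=> jk; apply/incidentP; exists (hub j.+1); rewrite val_hub_edge // set21.
Qed.

Lemma incident_rail_hub j i : j < k ->
  incident (rail_edge j i) (hub_edge j.+1 i).
Proof.
move=> jk; apply/incidentP; exists (rail j.+1 i); rewrite ?val_hub_edge ?set22 //.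
by rewrite val_rail_edge ?set22 // ltnW.
Qed.

Lemma incident_hub_rail j i : j < k ->
  incident (hub_edge j.+1 i) (rail_edge j.+1 i).
Proof.
move=> jk; apply/incidentP; exists (rail j.+1 i); rewrite ?val_hub_edge ?set22 //.
by rewrite val_rail_edge ?set21.
Qed.

Lemma incident_start i i' : incident (rail_edge 0 i) (rail_edge 0 i').
Proof.
apply/incidentP; exists (rail 0 i); rewrite val_rail_edge // ?set21 //.
by rewrite (rail_start k_gt0 i i') set21.
Qed.

Lemma incident_end i i' : incident (rail_edge k i) (rail_edge k i').
Proof.
apply/incidentP; exists (rail k.+1 i); rewrite val_rail_edge // ?set22 //.
by rewrite (rail_end k_gt0 i i') set22.
Qed.

(** One clause for each kind of vertex: start, end, hub, rail. *)
Definition locally_proper c :=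
  [/\ injective (c \o rail_edge 0), injective (c \o rail_edge k)
    & forall j, j < k -> injective (c \o hub_edge j.+1) /\
      forall i, [/\ c (rail_edge j i) <> c (hub_edge j.+1 i),
                    c (rail_edge j i) <> c (rail_edge j.+1 i)
                  & c (hub_edge j.+1 i) <> c (rail_edge j.+1 i)]].

Lemma proper_locally c : proper_coloring c -> locally_proper c.
Proof.
move/proper_coloringP => c_proper.
have inj (h : 'I_3 -> edge) : injective h ->
    (forall i i', incident (h i) (h i')) -> injective (c \o h).
  move=> h_inj h_inc i i' /= E; apply/eqP/negPn/negP => ii'.
  by apply: c_proper E; [rewrite (inj_eq h_inj) | exact: h_inc].
split=> [||j jk].
- by apply: inj incident_start => i i' /rail_edge_inj[].
- by apply: inj incident_end => i i' /rail_edge_inj[].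
split=> [|i].
  apply: inj => i i'; first by move/hub_edge_inj=> [].
  exact: incident_hub_edges.
split; apply: c_proper.
- by apply/eqP/rail_edge_neq_hub => //; exact: ltnW.
- exact: incident_rail_hub.
- by apply/eqP => /rail_edge_inj[] //; [exact: ltnW | lia].
- exact: incident_rail_edges.
- by apply/eqP/nesym/rail_edge_neq_hub.
- exact: incident_hub_rail.
Qed.

Lemma edges_at_rail j i f : j < k -> rail j.+1 i \in val f ->
  [\/ f = rail_edge j i, f = rail_edge j.+1 i | f = hub_edge j.+1 i].
Proof.
move=> jk; case: (ladder_edgeP f) => j' i' j'k.
- rewrite val_rail_edge // !inE => /orP[]/eqP E.
    have jj' : j.+1 = j' by apply: rail_inj_lev E; lia.
    by subst j'; rewrite (rail_inj k_gt0 _ E) //; constructor 2.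
  have jj' : j.+1 = j'.+1 by apply: rail_inj_lev E; lia.
  by case: jj' E => <- E; rewrite (rail_inj k_gt0 _ E) //; constructor 1.
- rewrite val_hub_edge // !inE => /orP[]/eqP E.
    by case: (rail_neq_hub k_gt0 _ E).
  have jj' : j.+1 = j'.+1 by apply: rail_inj_lev E; lia.
  by case: jj' E => <- E; rewrite (rail_inj k_gt0 _ E) //; constructor 3.
Qed.

Lemma edges_at_hub j f : j < k -> hub j.+1 \in val f ->
  exists i, f = hub_edge j.+1 i.
Proof.
move=> jk; case: (ladder_edgeP f) => j' i' j'k.
- rewrite val_rail_edge // !inE => /orP[]/eqP/esym E.
    by case: (rail_neq_hub k_gt0 _ E).
  by case: (rail_neq_hub k_gt0 _ E).
- rewrite val_hub_edge // !inE => /orP[]/eqP E.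
    have [-> //] : j.+1 = j'.+1 by apply: hub_inj E.
    by exists i'.
  by case: (rail_neq_hub k_gt0 _ (esym E)).
Qed.

Lemma edges_at_start i0 f : rail 0 i0 \in val f -> exists i, f = rail_edge 0 i.
Proof.
case: (ladder_edgeP f) => j' i' j'k.
- rewrite val_rail_edge // !inE => /orP[]/eqP E.
    have <- : 0 = j' by apply: rail_inj_lev E; lia.
    by exists i'.
  by have : 0 = j'.+1 by apply: rail_inj_lev E; lia.
- rewrite val_hub_edge // !inE => /orP[]/eqP E.
    by case: (rail_neq_hub k_gt0 _ E).
  by have : 0 = j'.+1 by apply: rail_inj_lev E; lia.
Qed.

Lemma edges_at_end i0 f : rail k.+1 i0 \in val f -> exists i, f = rail_edge k i.
Proof.
case: (ladder_edgeP f) => j' i' j'k.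
- rewrite val_rail_edge // !inE => /orP[]/eqP E.
    have : k.+1 = j' by apply: rail_inj_lev E; lia.
    by lia.
  have [<-] : k.+1 = j'.+1 by apply: rail_inj_lev E; lia.
  by exists i'.
- rewrite val_hub_edge // !inE => /orP[]/eqP E.
    by case: (rail_neq_hub k_gt0 _ E).
  have : k.+1 = j'.+1 by apply: rail_inj_lev E; lia.
  by lia.
Qed.

Lemma locally_proper_proper c : locally_proper c -> proper_coloring c.
Proof.
case=> c0 ck cj; apply/proper_coloringP => f g /eqP fg /incidentP[u].
case: (vertexP k_gt0 u) => [||[|j] i // jk|[|j] // jk].
- move/edges_at_start=> [i fE] /edges_at_start[i' gE] cfg; apply: fg.
  by rewrite fE gE in cfg *; rewrite (c0 _ _ cfg).
- move/edges_at_end=> [i fE] /edges_at_end[i' gE] cfg; apply: fg.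
  by rewrite fE gE in cfg *; rewrite (ck _ _ cfg).
- have [_ /(_ i)[c1 c2 c3]] := cj j jk.
  case/(edges_at_rail jk) => fE /(edges_at_rail jk)[] gE; rewrite fE gE in fg *;
    by [| exact: nesym].
- have [hj _] := cj j jk.
  move=> /(edges_at_hub jk)[i fE] /(edges_at_hub jk)[i' gE] cfg; apply: fg.
  by rewrite fE gE in cfg *; rewrite (hj _ _ cfg).
Qed.

(* By [derangement_shift], this bit and the colours of the rail edges leaving
   level j determine the colours at level j+1. *)
Definition turn c j := c (hub_edge j.+1 ord0) == c (rail_edge j (shift true ord0)).

(** By [derangement_shift], the colours of row j+1 are those of row j composed with a shift, so
    injectivity propagates from the start vertex. *)
Lemma rail_colours_inj c j : proper_coloring c -> j <= k ->
  injective (c \o rail_edge j).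
Proof.
move/proper_locally=> [c0 _ cj]; elim: j => // j IHj jk.
have [hj cv] := cj j jk; have rj := IHj (ltnW jk).
move=> i i' /= E; have [] := cv i; have [] := cv i'.
have rE i1 : c (rail_edge j.+1 i1) = c (rail_edge j (shift (~~ turn c j) i1)).
  by apply: (derangement_shift rj hj (c := c \o rail_edge j.+1) _ _ _ i1).2 => i2;
    have [] := cv i2.
by move: E; rewrite !rE => /rj /shift_inj.
Qed.

Lemma proper_turn c j i : proper_coloring c -> j < k ->
  c (hub_edge j.+1 i) = c (rail_edge j (shift (turn c j) i)) /\
  c (rail_edge j.+1 i) = c (rail_edge j (shift (~~ turn c j) i)).
Proof.
move=> c_proper jk; have [_ _ /(_ j jk)[hj cv]] := proper_locally c_proper.
have rj := rail_colours_inj c_proper (ltnW jk).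
by apply: (derangement_shift rj hj (c := c \o rail_edge j.+1)) => i1; have [] := cv i1.
Qed.

Lemma eq_proper_coloring c c' : proper_coloring c -> proper_coloring c' ->
    (forall j, j < k -> turn c j = turn c' j) ->
    (forall i, c (rail_edge 0 i) = c' (rail_edge 0 i)) -> c = c'.
Proof.
move=> c_proper c'_proper tE E0.
have rE j i : j <= k -> c (rail_edge j i) = c' (rail_edge j i).
  elim: j i => // j IHj i jk.
  by rewrite (proper_turn i c_proper jk).2 (proper_turn i c'_proper jk).2 tE // IHj // ltnW.
apply/ffunP => f; case: (ladder_edgeP f) => j i jk; first exact: rE.
by rewrite (proper_turn i c_proper jk).1 (proper_turn i c'_proper jk).1 tE // rE // ltnW.
Qed.

(** * Colourings with prescribed turns *)

(** The recursion of [proper_turn] unrolled, starting with colour i on rail i. *)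
Fixpoint rail_shifts (t : nat -> bool) j i : 'I_3 :=
  if j is j'.+1 then rail_shifts t j' (shift (~~ t j') i) else i.

Lemma rail_shifts_inj t j : injective (rail_shifts t j).
Proof. by elim: j => [//|j IHj] i i' /= /IHj /shift_inj. Qed.

(** [pick] decodes an edge into its coordinates, which are unique. By [ladder_edgeP] the final
    [ord0] is never reached. *)
Definition turn_coloring (t : nat -> bool) : coloring := [ffun f =>
  if [pick p : 'I_k.+1 * 'I_3 | f == rail_edge p.1 p.2] is Some p
  then rail_shifts t p.1 p.2
  else if [pick p : 'I_k * 'I_3 | f == hub_edge p.1.+1 p.2] is Some p
  then rail_shifts t p.1 (shift (t p.1) p.2) else ord0].

Lemma turn_coloring_rail t j i : j <= k ->
  turn_coloring t (rail_edge j i) = rail_shifts t j i.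
Proof.
move=> jk; rewrite ffunE; case: pickP => [[j' i'] /= /eqP/rail_edge_inj[] //|].
- by rewrite -ltnS.
- by move=> -> ->.
by move/(_ (Ordinal (jk : j < k.+1), i)); rewrite eqxx.
Qed.

Lemma turn_coloring_hub t j i : j < k ->
  turn_coloring t (hub_edge j.+1 i) = rail_shifts t j (shift (t j) i).
Proof.
move=> jk; rewrite ffunE; case: pickP => [[j' i'] /= /eqP/esym/rail_edge_neq_hub E|_].
  by case: E; rewrite // -ltnS.
case: pickP => [[j' i'] /= /eqP/hub_edge_inj[] // -> -> //|].
by move/(_ (Ordinal jk, i)); rewrite eqxx.
Qed.

Lemma turn_coloring_proper t : proper_coloring (turn_coloring t).
Proof.
apply: locally_proper_proper; split=> [i i'|i i'|j jk].
- by rewrite /= !turn_coloring_rail.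
- by rewrite /= !turn_coloring_rail //; apply: rail_shifts_inj.
have jk' := ltnW jk.
split=> [i i'|i]; first by rewrite /= !turn_coloring_hub // => /rail_shifts_inj/shift_inj.
rewrite turn_coloring_hub ?turn_coloring_rail //=; split=> /rail_shifts_inj.
- by move/esym/shift_neq.
- by move/esym/shift_neq.
- exact: shift_negb.
Qed.

Lemma turn_turn_coloring t j : j < k -> turn (turn_coloring t) j = t j.
Proof.
move=> jk; rewrite /turn turn_coloring_hub // turn_coloring_rail; last exact: ltnW.
by rewrite (inj_eq (@rail_shifts_inj t j)) shift_from0.
Qed.

(* Walking away from the start vertex, the two rails whose edges avoid the
   third colour stay connected: when a rail acquires that colour, the path
   leaves it through the hub towards the rail that has just lost it. *)
Lemma proper_kempe_connected c : proper_coloring c -> kempe_connected c.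
Proof.
move=> c_proper a b f g ab; have [m mP] := third_colour ab; rewrite !mP => fm gm.
pose R := connect (ab_rel c a b).
have R_sym : symmetric R := sym_connect_sym (@ab_rel_sym _ _ c a b).
have step f1 f2 : c f1 != m -> c f2 != m -> incident f1 f2 -> R f1 f2.
  by move=> f1m f2m inc; apply: connect1; rewrite /ab_rel !mP f1m f2m.
have [i0 i0m] : exists i0, c (rail_edge 0 i0) != m.
  have r0 := rail_colours_inj c_proper (leq0n k).
  case: (c (rail_edge 0 ord0) =P m) => [E|/eqP]; last by exists ord0.
  exists (shift true ord0); apply/eqP; rewrite -E => /r0; exact: shift_neq.
have railR j i : j <= k -> c (rail_edge j i) != m -> R (rail_edge 0 i0) (rail_edge j i).
  elim: j i => [|j IHj] i jk im; first exact: step (incident_start _ _).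
  have rj := rail_colours_inj c_proper (ltnW jk).
  have [_ _ /(_ j jk)[hj /(_ i)[c1 c2 c3]]] := proper_locally c_proper.
  case: (c (rail_edge j i) =P m) => [Ei|/eqP rm]; last first.
    apply: connect_trans (IHj i (ltnW jk) rm) _.
    exact: step (incident_rail_edges _ _).
  have him : c (hub_edge j.+1 i) != m by apply/eqP; rewrite -Ei; exact: nesym.
  (* Of the other two edges at this hub, at most one has colour [m]. *)
  have [d hdm] : exists d, c (hub_edge j.+1 (shift d i)) != m.
    case: (c (hub_edge j.+1 (shift true i)) =P m) => [E|/eqP]; last by exists true.
    by exists false; apply/eqP; rewrite -E => /hj /esym; exact: (@shift_negb true).
  have rdm : c (rail_edge j (shift d i)) != m.
    by apply/eqP; rewrite -Ei => /rj; exact: shift_neq.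
  apply: connect_trans (IHj _ (ltnW jk) rdm) _.
  apply: connect_trans (step _ _ rdm hdm (incident_rail_hub _ _)) _ => //.
  apply: connect_trans (step _ _ hdm him (incident_hub_edges _ _ _)) _ => //.
  exact: step (incident_hub_rail _ _).
have allR f1 : c f1 != m -> R (rail_edge 0 i0) f1.
  case: (ladder_edgeP f1) => j i jk im; first exact: railR.
  have [_ _ /(_ j jk)[_ /(_ i)[c1 c2 c3]]] := proper_locally c_proper.
  case: (c (rail_edge j i) =P m) => [E|/eqP rm].
    have rm : c (rail_edge j.+1 i) != m by apply/eqP; rewrite -E; exact: nesym.
    apply: connect_trans (railR j.+1 i jk rm) _; rewrite -/(R _ _) R_sym.
    exact: step (incident_hub_rail _ _).
  apply: connect_trans (railR j i (ltnW jk) rm) _.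
  exact: step (incident_rail_hub _ _).
by apply: connect_trans (allR g gm); rewrite -/(R _ _) R_sym; apply: allR.
Qed.

(** * Kempe classes and their count *)

Lemma turn_recolour s c j : turn (recolour s c) j = turn c j.
Proof. by rewrite /turn !ffunE (inj_eq perm_inj). Qed.

(** A switch is a global transposition, and [turn] only tests equality of two colours. *)
Lemma kempe_step_turn c c' j : proper_coloring c -> kempe_step c c' ->
  turn c' j = turn c j.
Proof.
move=> c_proper /existsP[a /existsP[b /existsP[f /and3P[ab cf /eqP->]]]].
by rewrite (kempe_switch_recolour (proper_kempe_connected c_proper)) ?turn_recolour.
Qed.

Lemma connect_turn c c' j : connect (@kempe_rel _ ladder) c c' -> turn c' j = turn c j.
Proof.
case/connectP=> p; elim: p c => [|c1 p IHp] c /=; first by move=> _ ->.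
case/andP=> /and3P[c_proper c1_proper cc1] pth cE; rewrite (IHp c1) //.
by case/orP: cc1 => /kempe_step_turn ->.
Qed.

Lemma kempe_rel_tperm c a b : proper_coloring c -> a != b ->
  kempe_rel c (recolour (tperm a b) c).
Proof.
move=> c_proper ab; rewrite /kempe_rel c_proper recolour_proper //=.
have [r _ rK] := injF_bij (rail_colours_inj c_proper (leq0n k)).
(* The start vertex sees all three colours, so an edge of colour [a] is found there to begin the
   chain. *)
have cf : c (rail_edge 0 (r a)) \in [:: a; b] by rewrite [c _]rK mem_head.
apply/orP; left; apply/existsP; exists a; apply/existsP; exists b.
apply/existsP; exists (rail_edge 0 (r a)); rewrite ab cf.
by rewrite (kempe_switch_recolour (proper_kempe_connected c_proper)) //= eqxx.
Qed.

(** Factor [s] into transpositions; each is realised by one switch. *)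
Lemma connect_recolour s c : proper_coloring c ->
  connect (@kempe_rel _ ladder) c (recolour s c).
Proof.
have [ts -> ts_dpair] := prod_tpermP s.
elim: ts ts_dpair c => [_|[a b] ts IHts /= /andP[ab ts_dpair]] c c_proper.
  suff -> : recolour (\prod_(t <- [::]) tperm t.1 t.2) c = c by exact: connect0.
  by apply/ffunP => f; rewrite ffunE big_nil perm1.
rewrite big_cons /=; set s' := (X in (_ * X)%g).
have -> : recolour (tperm a b * s')%g c = recolour s' (recolour (tperm a b) c).
  by apply/ffunP => f; rewrite !ffunE permM.
apply: connect_trans (connect1 (kempe_rel_tperm c_proper ab)) (IHts _ _ _) => //.
exact: recolour_proper.
Qed.

Lemma connect_same_turn c c' : proper_coloring c -> proper_coloring c' ->
  (forall j, j < k -> turn c j = turn c' j) -> connect (@kempe_rel _ ladder) c c'.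
Proof.
move=> c_proper c'_proper tE.
have r_inj := rail_colours_inj c_proper (leq0n k).
have r'_inj := rail_colours_inj c'_proper (leq0n k).
(* [s] carries the colours that [c] gives at the start vertex to those of [c']. *)
pose s := ((perm r_inj)^-1 * perm r'_inj)%g.
suff -> : c' = recolour s c by exact: connect_recolour.
apply: eq_proper_coloring => // [|j jk|i]; first exact: recolour_proper.
  by rewrite turn_recolour tE.
have -> : c' (rail_edge 0 i) = perm r'_inj i by rewrite permE.
have -> : recolour s c (rail_edge 0 i) = s (perm r_inj i) by rewrite ffunE [in RHS]permE.
by rewrite permM permK.
Qed.

Lemma ladder_Kprime3 : Kprime3 ladder = 2 ^ k.
Proof.
pose R := connect (@kempe_rel _ ladder).
have R_sym : symmetric R.
  apply: sym_connect_sym => c c'; rewrite /kempe_rel andbCA orbC.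
  by rewrite andbCA.
have R_trans : transitive R := @connect_trans _ _.
(* Bits are indexed by ['I_k] for counting and extended by [false] for [turn_coloring]. *)
pose t (d : {ffun 'I_k -> bool}) j := oapp d false (insub j).
have tE (d : {ffun 'I_k -> bool}) (j : 'I_k) : t d j = d j by rewrite /t valK.
pose class c := [set c' | R c c'].
have class_eq c c' : R c c' -> class c = class c'.
  by move=> cc'; apply/setP => x; rewrite !inE; apply: same_connect.
pose h d := class (turn_coloring (t d)).
have h_inj : injective h.
  move=> d d' /setP/(_ (turn_coloring (t d'))); rewrite !inE [in RHS]/R connect0.
  move=> dd'; apply/ffunP => j.
  by have := connect_turn j dd'; rewrite !turn_turn_coloring // !tE.
rewrite /Kprime3 -[X in X ^ _]card_bool -[X in _ ^ X](card_ord k) -card_ffun.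
rewrite -cardsT -(card_imset _ h_inj); apply: eq_card => A.
apply/imsetP/imsetP => [[c c_proper ->]|[d _ ->]]; last first.
  by exists (turn_coloring (t d)); first exact: turn_coloring_proper.
exists [ffun j : 'I_k => turn c j] => //; apply: class_eq.
apply: connect_same_turn => //; first exact: turn_coloring_proper.
by move=> j jk; rewrite turn_turn_coloring // (tE _ (Ordinal jk)) ffunE.
Qed.

End LadderColourings.

Theorem theorem22 (k : nat) : 1 <= k ->
  exists e : rel 'I_(4 * k + 2),
    [/\ simple_graph e, k_connected 3 e, ~ planar e, bipartite e
      & cubic e /\ Kprime3 e = 2 ^ k].
Proof.
move=> k_gt0; rewrite addn2; exists (@ladder k); split.
- exact: ladder_simple.
- exact: ladder_3connected.
- exact: ladder_nonplanar.
- exact: ladder_bipartite.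
- by split; [exact: ladder_cubic | exact: ladder_Kprime3].
Qed.
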